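(* Let $(\mathbb{R}^2,\|\cdot\|)$ be a smooth Minkowski plane and let the weight function be linear, $w(t)=d+ht$ with $d>0$ and $h\ge 0$. Then every Steiner point in a minimum Gilbert arborescence (for any finite set of sources with positive flows and a single sink in this plane, with weight function $w$) has degree $3$.
   Context: A Minkowski plane is $\mathbb{R}^2$ endowed with a norm $\|\cdot\|$; it is smooth if the norm is differentiable at every $x\neq o$, where $o$ is the origin. Given a set of terminals $\{p_1,\dots,p_n,q\}$ in the plane, where $p_1,\dots,p_n$ are sources with positive flows $t_1,\dots,t_n$ and $q$ is the sink, a Gilbert arborescence is a tree (with straight edges) whose vertices are the terminals together with finitely many (possibly zero) additional points, called Steiner points, at arbitrary locations. The flow $t_i$ is routed from $p_i$ to $q$ along the unique path in the tree from $p_i$ to $q$. The total flow $t_e$ on an edge $e$ is the sum of the $t_i$ over all $i$ such that the path from $p_i$ to $q$ uses $e$. The cost of an edge $e=xy$ is $w(t_e)\|x-y\|$, and the cost of the arborescence is the sum of the costs of its edges. A minimum Gilbert arborescence (MGA) is a Gilbert arborescence of globally minimum cost among all Gilbert arborescences for the same terminals, flows and weight function (the number, location and adjacency of Steiner points being free). Conventions: the vertices of the arborescence are distinct points (no edge has length zero), and a Steiner point has degree at least $3$ (a non-terminal vertex of degree at most $2$ is superfluous and is not counted as a Steiner point). *)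

(* Defs.v *)
From HB Require Import structures.
From mathcomp Require Export all_boot all_order all_algebra finmap.
From mathcomp Require Export all_classical all_reals all_analysis.
Export Order.TTheory GRing.Theory Num.Theory.
Export numFieldNormedType.Exports.
#[export] Set Implicit Arguments.
#[export] Unset Strict Implicit.
#[export] Unset Printing Implicit Defensive.
Local Open Scope fset_scope.
Local Open Scope ring_scope.

Record is_norm (R : realType) (N : 'rV[R]_2 -> R) : Prop := IsNorm {
  norm_triangle : forall x y, N (x + y) <= N x + N y;
  norm_homog : forall (a : R) x, N (a *: x) = `|a| * N x;
  norm_definite : forall x, N x = 0 -> x = 0 }.

(* [differentiable] is Frechet differentiability with respect to the library's
   sup norm on 'rV[R]_2; all norms on this space are equivalent, so the notion
   does not depend on that choice. *)
Definition smooth_norm (R : realType) (N : 'rV[R]_2 -> R) : Prop :=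
  forall x : 'rV[R]_2, x != 0 -> differentiable N x.

Definition terminal (R : realType) (n : nat) (p : 'I_n -> 'rV[R]_2)
    (q : 'rV[R]_2) (u : 'rV[R]_2) : bool :=
  (u == q) || [exists i, u == p i].

(* The vertices are points of the plane, hence pairwise distinct; together with
   the irreflexivity of [edge] this excludes edges of length zero. *)
Record arborescence (R : realType) (n : nat) (p : 'I_n -> 'rV[R]_2)
    (q : 'rV[R]_2) := Arborescence {
  verts : {fset 'rV[R]_2};
  edge : rel 'rV[R]_2;
  edge_verts : forall u v, edge u v -> (u \in verts) && (v \in verts);
  edge_sym : symmetric edge;
  edge_irr : irreflexive edge;
  tree_connected : forall u v, u \in verts -> v \in verts ->
    exists s, path edge u s /\ last u s = v;
  tree_acyclic : forall c, (2 < size c)%N -> ~ ucycle edge c;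
  source_verts : forall i, p i \in verts;
  sink_verts : q \in verts;
  steiner_degree : forall u, u \in verts -> ~~ terminal p q u ->
    (3 <= #|` [fset v in verts | edge u v]|)%N }.

Section Cost.
Context (R : realType) (n : nat) (p : 'I_n -> 'rV[R]_2) (q : 'rV[R]_2).
Implicit Types (A : arborescence p q) (u v : 'rV[R]_2).

Definition degree A u : nat := #|` [fset v in verts A | edge A u v]|.

Definition steiner_point A u : bool := (u \in verts A) && ~~ terminal p q u.

(* [s] lists the vertices after [p i] on a simple path from [p i] to [q]; in a
   tree this path is unique. The edge uv is used if it is traversed in either
   direction. *)
Definition uses_edge A (i : 'I_n) u v : bool :=
  `[< exists s : seq 'rV[R]_2,
      [/\ path (edge A) (p i) s, uniq (p i :: s), last (p i) s = q
        & ((u, v) \in zip (p i :: s) s) || ((v, u) \in zip (p i :: s) s)] >].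

Definition flow (t : 'I_n -> R) A u v : R := \sum_(i < n | uses_edge A i u v) t i.

(* The double sum visits each edge as the two ordered pairs (u, v) and (v, u),
   whence the factor 1/2. *)
Definition cost (N : 'rV[R]_2 -> R) (w : R -> R) (t : 'I_n -> R) A : R :=
  2^-1 * \sum_(u <- verts A) \sum_(v <- verts A | edge A u v)
           w (flow t A u v) * N (u - v).

Definition minimum_arborescence (N : 'rV[R]_2 -> R) (w : R -> R)
    (t : 'I_n -> R) A : Prop :=
  forall B : arborescence p q, cost N w t A <= cost N w t B.

End Cost.

(* Main.v *)
(* Let s be a Steiner point of degree at least 4, so that it has three children
   besides its parent (its neighbour towards the sink). Let a_i = w_i g_i, where
   w_i = d + h t_i is the weight of the edge to the i-th child and g_i the
   gradient of the norm along that edge, and let b, w_b = d + h T be the same for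
   the edge to the parent. Pulling two edges away from s onto a new vertex close
   to s cannot lower the cost, and to first order this says, for the dual norm,
     |a_i + a_k| <= d + h (t_i + t_k),   |b + a_i| <= d + h (T - t_i),
   whence |a_i + a_k| + |b + a_i| <= |a_k| + |b| and |a_i + a_k| < |a_i| + |a_k|.
   If a_i lies in the cone spanned by b and a_k, then a_k and b are opposite sides
   of a convex quadrilateral with diagonals a_i + a_k and b + a_i, which
   contradicts the quadrilateral inequality; it is strict because the dual of a
   smooth norm is strictly convex. So each open side of the line spanned by b
   contains at most one a_i, the line itself can contain an a_i only if it
   contains all of them, and then two of them point in the same direction and
   violate |a_i + a_k| < |a_i| + |a_k|. Hence there are at most two children. *)

Require Import Defs.
From mathcomp Require Import ring lra.
Local Open Scope fset_scope.
Local Open Scope ring_scope.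

(** * Dual norm of a smooth plane *)

Definition pairing (R : realType) (a z : 'rV[R]_2) : R :=
  a 0 0 * z 0 0 + a 0 1 * z 0 1.

Definition wedge (R : realType) (a b : 'rV[R]_2) : R :=
  a 0 0 * b 0 1 - a 0 1 * b 0 0.

(** Only one-sided increments along a fixed direction are controlled, without uniformity in [z]: the
    cost comparison moves a new vertex along a single ray. *)
Definition gradient (R : realType) (N : 'rV[R]_2 -> R) (x g : 'rV[R]_2) : Prop :=
  forall z e, 0 < e -> exists2 r, 0 < r & forall eps, 0 < eps -> eps < r ->
    `|N (x + eps *: z) - N x - eps * pairing g z| <= e * eps.

(* The dual norm of [a] is at most [w]. *)
Definition dual_le (R : realType) (N : 'rV[R]_2 -> R) (a : 'rV[R]_2) (w : R) : Prop :=
  forall z, pairing a z <= w * N z.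

Section Planar.
Context (R : realType) (N : 'rV[R]_2 -> R).
Implicit Types (a b g x z P Q : 'rV[R]_2).

Lemma pairingDl a b z : pairing (a + b) z = pairing a z + pairing b z.
Proof. by rewrite /pairing !mxE; ring. Qed.

Lemma pairingZl (c : R) a z : pairing (c *: a) z = c * pairing a z.
Proof. by rewrite /pairing !mxE; ring. Qed.

Lemma pairingNl a z : pairing (- a) z = - pairing a z.
Proof. by rewrite /pairing !mxE; ring. Qed.

Lemma pairingDr a x z : pairing a (x + z) = pairing a x + pairing a z.
Proof. by rewrite /pairing !mxE; ring. Qed.

Lemma pairingZr (c : R) a z : pairing a (c *: z) = c * pairing a z.
Proof. by rewrite /pairing !mxE; ring. Qed.

Lemma pairingNr a z : pairing a (- z) = - pairing a z.
Proof. by rewrite /pairing !mxE; ring. Qed.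

Lemma row2P a b : a 0 0 = b 0 0 -> a 0 1 = b 0 1 -> a = b.
Proof.
move=> h0 h1; apply/rowP => j; case: (unliftP 0 j) => [k ->|-> //].
by rewrite (_ : lift 0 k = 1) //; apply/val_inj; rewrite /= ord1.
Qed.

Lemma pairing_inj a b : (forall z, pairing a z = pairing b z) -> a = b.
Proof.
by move=> ab; apply: row2P; [have := ab (delta_mx 0 0) | have := ab (delta_mx 0 1)];
  rewrite /pairing !mxE /= !mulr0 ?mulr1 ?addr0 ?add0r.
Qed.

Lemma differentiable_gradient x : differentiable N x -> exists g, gradient N x g.
Proof.
move=> dN.
pose g : 'rV[R]_2 := \row_j 'd N x (delta_mx 0 j).
have dE z : 'd N x z = pairing g z.
  rewrite [in LHS](row_sum_delta z) big_ord_recl big_ord1 linearD !linearZ /=.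
  by rewrite /pairing !mxE mulrC [X in _ + X]mulrC (_ : lift ord0 ord0 = 1) //; apply/val_inj.
exists g => z e e_gt0.
have := derivable_nbhs (@diff_derivable _ _ _ N x z dN).
rewrite deriveE // dE => /eqaddoP /(_ e e_gt0).
rewrite -nbhs_nearE => /nbhs_ballP [r r_gt0 hr]; exists r => // eps eps_gt0 eps_lt.
have := hr eps; rewrite -ball_normE /= sub0r normrN (gtr0_norm eps_gt0) => /(_ eps_lt).
by rewrite !fctE /= /cst opprD addrA [eps *: z + x]addrC.
Qed.

Lemma gradient_ge x g z (c : R) : gradient N x g ->
  (forall eps, 0 < eps -> eps * c <= N (x + eps *: z) - N x) -> c <= pairing g z.
Proof.
move=> gx hc; apply/ler_addgt0Pr => e e_gt0.
have [r r_gt0 hr] := gx z e e_gt0.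
have r2 : 0 < r / 2 by rewrite divr_gt0.
have /ler_normlP[_ h1] := hr (r / 2) r2 ltac:(lra).
rewrite -(ler_pM2l r2); have := hc _ r2; nra.
Qed.

Lemma gradient_le x g z (c : R) : gradient N x g ->
  (forall eps, 0 < eps -> N (x + eps *: z) - N x <= eps * c) -> pairing g z <= c.
Proof.
move=> gx hc; apply/ler_addgt0Pr => e e_gt0.
have [r r_gt0 hr] := gx z e e_gt0.
have r2 : 0 < r / 2 by rewrite divr_gt0.
have /ler_normlP[h1 _] := hr (r / 2) r2 ltac:(lra).
rewrite -(ler_pM2l r2); have := hc _ r2; nra.
Qed.

Hypothesis N_norm : is_norm N.

Lemma norm_opp z : N (- z) = N z.
Proof. by rewrite -scaleN1r (norm_homog N_norm) normrN1 mul1r. Qed.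

Lemma norm_ge0 z : 0 <= N z.
Proof.
have := norm_triangle N_norm z (- z).
by rewrite subrr norm_opp -(scale0r z) (norm_homog N_norm) normr0 mul0r; lra.
Qed.

Lemma norm_gt0 z : z != 0 -> 0 < N z.
Proof.
move=> z0; rewrite lt_neqAle norm_ge0 andbT eq_sym.
by apply: contra_neq z0; apply: (norm_definite N_norm).
Qed.

Lemma gradient_dual_le x g : gradient N x g -> dual_le N g 1.
Proof.
move=> gx z; rewrite mul1r; apply: gradient_le gx _ => eps eps_gt0.
have := norm_triangle N_norm x (eps *: z).
by rewrite (norm_homog N_norm) gtr0_norm //; lra.
Qed.

(** Euler's identity for a function homogeneous of degree 1. *)
Lemma gradient_self x g : gradient N x g -> pairing g x = N x.
Proof.
have normE eps : 0 < eps -> N (x + eps *: x) - N x = eps * N x.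
  move=> eps_gt0; rewrite -[X in N (X + _)]scale1r -scalerDl (norm_homog N_norm).
  by rewrite gtr0_norm; lra.
move=> gx; apply/eqP; rewrite eq_le; apply/andP; split.
  by apply: gradient_le gx _ => eps /normE ->.
by apply: gradient_ge gx _ => eps /normE ->.
Qed.

(** The function [p * N - P] is nonnegative and vanishes at [x], so its derivative there,
    [p *: g - P], is nonnegative in every direction; a linear form with this property is zero. *)
Lemma support_gradient x g P (p : R) : gradient N x g ->
  dual_le N P p -> pairing P x = p * N x -> P = p *: g.
Proof.
move=> gx Pp Px; apply: pairing_inj => z; rewrite pairingZl.
have key y : pairing P y <= p * pairing g y.
  apply/ler_addgt0Pr => e e_gt0.
  (* The sign of [p] is free and [p] may vanish, so the tolerance is divided by [|p| + 1]. *)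
  have p1 : 0 < `|p| + 1 by rewrite ltr_wpDl.
  have [r r_gt0 hr] := gx y (e / (`|p| + 1)) (divr_gt0 e_gt0 p1).
  have r2 : 0 < r / 2 by rewrite divr_gt0.
  have h1 := hr (r / 2) r2 ltac:(lra).
  rewrite -(ler_pM2l r2).
  have := Pp (x + (r / 2) *: y); rewrite pairingDr pairingZr Px.
  move: h1; set n1 := N (x + _); set n0 := N x => h1 h2.
  have h3 : p * (n1 - n0 - r / 2 * pairing g y) <= e * (r / 2).
    apply: (le_trans (ler_norm _)); rewrite normrM.
    apply: (le_trans (ler_wpM2l (normr_ge0 p) h1)).
    rewrite [X in X <= _]mulrA; apply: ler_wpM2r (ltW r2) _ _ _.
    rewrite mulrCA ler_piMr ?(ltW e_gt0) //.
    by rewrite ler_pdivrMr // mul1r lerDl.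
  lra.
apply/eqP; rewrite eq_le key /=.
by have := key (- z); rewrite !pairingNr; lra.
Qed.

Hypothesis N_smooth : smooth_norm N.

(* Strict convexity of the dual norm, which is what smoothness means in the plane. *)
Lemma support_parallel x P Q (p q : R) : x != 0 ->
  dual_le N P p -> dual_le N Q q -> pairing P x = p * N x -> pairing Q x = q * N x ->
  wedge P Q = 0.
Proof.
move=> x0 Pp Qq Px Qx; have [g gx] := differentiable_gradient (N_smooth x0).
rewrite (support_gradient gx Pp Px) (support_gradient gx Qq Qx) /wedge !mxE; ring.
Qed.

(** A direction attaining the dual norm is part of the data: the equality cases below are evaluated
    there, and no compactness argument is required to find it. *)
Definition dual_eq a (w : R) : Prop :=
  dual_le N a w /\ exists2 x, x != 0 & pairing a x = w * N x.

Lemma dual_leN a (w : R) : dual_le N a w -> dual_le N (- a) w.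
Proof. by move=> aw z; rewrite pairingNl -pairingNr -(norm_opp z). Qed.

Lemma dual_eq_neq0 a (w : R) : dual_eq a w -> 0 < w -> a != 0.
Proof.
move=> [_ [x x0 ax]] w_gt0; apply: contra_eq_neq ax => ->.
by rewrite /pairing !mxE !mul0r addr0 eq_sym mulf_neq0 ?gt_eqF ?norm_gt0.
Qed.

(** * Planar configurations excluded by bounds on the dual norm *)

Lemma wedgeC a b : wedge a b = - wedge b a.
Proof. by rewrite /wedge; ring. Qed.

Lemma wedgeNl a b : wedge (- a) b = - wedge a b.
Proof. by rewrite /wedge !mxE; ring. Qed.

Lemma wedgeNr a b : wedge a (- b) = - wedge a b.
Proof. by rewrite /wedge !mxE; ring. Qed.

(** Cramer's rule in the basis [b], [a]. *)
Lemma wedge_solve b a c : wedge b a != 0 ->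
  c = (wedge c a / wedge b a) *: b + (wedge b c / wedge b a) *: a.
Proof. by move=> ba; apply: row2P; rewrite !mxE; move: ba; rewrite /wedge => ba; field. Qed.

Lemma wedge0_scale b a : b != 0 -> wedge b a = 0 -> exists c, a = c *: b.
Proof.
move=> b0; rewrite /wedge => ba.
have [b00|b00] := eqVneq (b 0 0) 0.
  have b01 : b 0 1 != 0.
    by apply: contra_neq b0 => b01; apply: row2P; rewrite mxE.
  exists (a 0 1 / b 0 1); apply: row2P; rewrite mxE; last by field.
  apply: (mulIf b01); rewrite b00 mulr0 mul0r.
  by move: ba; rewrite b00; lra.
exists (a 0 0 / b 0 0); apply: row2P; rewrite mxE; first by field.
by rewrite mulrAC; apply: (canRL (mulfK b00)); lra.
Qed.

(* Quadrilateral inequality: [a_k] and [b] are opposite sides of a convex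
   quadrilateral whose diagonals are [a_i + a_k] and [b + a_i]. *)
Lemma cone_exclusion ak b (wk wb p q al ga : R) :
  dual_eq ak wk -> dual_eq b wb -> wedge b ak != 0 -> 0 <= al -> 0 <= ga -> 0 < al + ga ->
  p + q = wk + wb ->
  dual_le N (al *: b + ga *: ak + ak) p -> dual_le N (b + (al *: b + ga *: ak)) q -> False.
Proof.
move=> [_ [x x0 akx]] [_ [y y0 b_y]] bak al0 ga0 alga pq.
set P := _ + ak; set Q := b + _ => Pp Qq.
have NQ := dual_leN Qq.
have PE z : pairing P z = al * pairing b z + (ga + 1) * pairing ak z.
  by rewrite /P !pairingDl !pairingZl; ring.
have QE z : pairing Q z = (al + 1) * pairing b z + ga * pairing ak z.
  by rewrite /Q !pairingDl !pairingZl; ring.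
have PQ : wedge P Q = - (1 + al + ga) * wedge b ak.
  by rewrite /wedge /P /Q !mxE; ring.
have PQ0 : wedge P Q != 0 by rewrite PQ mulf_neq0 // oppr_eq0; apply/eqP; lra.
have NPQ0 : wedge (- P) Q != 0.
  by rewrite wedgeNl oppr_eq0.
have PNQ0 : wedge P (- Q) != 0.
  by rewrite wedgeNr oppr_eq0.
have Nx := norm_gt0 x0; have Ny := norm_gt0 y0.
have hPx := Pp x; have hPy := dual_leN Pp y; have hQx := NQ x; have hQy := Qq y.
rewrite pairingNl in hPy; rewrite pairingNl in hQx.
(* The sides in terms of the diagonals: [(1 + al + ga) ak = (1 + al) P - al Q] and
   [(1 + al + ga) b = (1 + ga) Q - ga P], each evaluated where its left side attains its dual
   norm. *)
have ex : (1 + al + ga) * (wk * N x) = (1 + al) * pairing P x + al * - pairing Q x.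
  by rewrite -akx PE QE; ring.
have ey : (1 + al + ga) * (wb * N y) = (1 + ga) * pairing Q y + ga * - pairing P y.
  by rewrite -b_y PE QE; ring.
have lx : (1 + al + ga) * wk <= (1 + al) * p + al * q.
  rewrite -(ler_pM2r Nx) -mulrA ex; nra.
have ly : (1 + al + ga) * wb <= (1 + ga) * q + ga * p.
  rewrite -(ler_pM2r Ny) -mulrA ey; nra.
(* The two upper bounds add up to [(1 + al + ga) (p + q)]. As [p + q = wk + wb], both inequalities
   are equalities. *)
have sum : (1 + al + ga) * wk + (1 + al + ga) * wb =
    ((1 + al) * p + al * q) + ((1 + ga) * q + ga * p).
  have -> : wk = p + q - wb by lra.
  ring.
have {}lx : (1 + al + ga) * wk = (1 + al) * p + al * q by apply/eqP; rewrite eq_le lx /=; lra.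
have {}ly : (1 + al + ga) * wb = (1 + ga) * q + ga * p by lra.
rewrite mulrA lx in ex; rewrite mulrA ly in ey.
(* If [al > 0], equality at [x] makes [P] and [- Q] attain their bounds at the same point, so they
   are parallel. If [al = 0], then [ga > 0] and the same happens to [- P] and [Q] at [y]. *)
have [al_gt0|] := ltP 0 al.
  have tx : - pairing Q x = q * N x.
    apply/eqP; rewrite eq_le hQx /=.
    rewrite -(ler_pM2l al_gt0); nra.
  move/eqP: PNQ0; apply; apply: (support_parallel x0 Pp NQ); last by rewrite pairingNl.
  apply: (mulfI (x := 1 + al)); first by apply/eqP; lra.
  by have := ex; rewrite tx; lra.
move=> al_le0; have ga_gt0 : 0 < ga by lra.
have ty : - pairing P y = p * N y.
  apply/eqP; rewrite eq_le hPy /=.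
  rewrite -(ler_pM2l ga_gt0); nra.
move/eqP: NPQ0; apply; apply: (support_parallel y0 (dual_leN Pp) Qq); first by rewrite pairingNl.
apply: (mulfI (x := 1 + ga)); first by apply/eqP; lra.
by have := ey; rewrite ty; lra.
Qed.

Lemma dual_eq_scale b (wb c w : R) : dual_eq b wb -> dual_eq (c *: b) w -> w = `|c| * wb.
Proof.
move=> [bw [y y0 b_y]] [cw [x x0 cx]]; apply/eqP; rewrite eq_le; apply/andP; split.
  rewrite -(ler_pM2r (norm_gt0 x0)) -cx pairingZl -mulrA.
  have [c0|c0] := leP 0 c; first by rewrite (ger0_norm c0) ler_wpM2l.
  rewrite (ltr0_norm c0) -mulrNN ler_wpM2l ?oppr_ge0 ?(ltW c0) // -pairingNr -(norm_opp x).
  exact: bw.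
rewrite -(ler_pM2r (norm_gt0 y0)) -mulrA -b_y.
have := cw y; have := cw (- y); rewrite norm_opp pairingNr pairingZl.
by have [c0|c0] := leP 0 c; rewrite ?(ger0_norm c0) ?(ltr0_norm c0); lra.
Qed.

(** Here the other child's vector is [- al *: b], opposite to [b]. Since [Q - P = (1 + al) b] has
    dual norm [p + q], the triangle inequality is an equality, so [- P] and [Q] attain their bounds
    at the same [y] and are parallel; this would put [aj] on the line of [b]. *)
Lemma opposite_exclusion aj b (wb p q al : R) :
  dual_eq b wb -> wedge b aj != 0 -> 0 < al -> p + q = al * wb + wb ->
  dual_le N (- al *: b + aj) p -> dual_le N (b + aj) q -> False.
Proof.
move=> [_ [y y0 b_y]] baj al_gt0 pq.
set P := - al *: b + aj; set Q := b + aj => Pp Qq.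
have hP := dual_leN Pp y; have hQ := Qq y; rewrite pairingNl in hP.
have E : pairing Q y + - pairing P y = (p + q) * N y.
  by rewrite pq mulrDl -mulrA -b_y /P /Q !pairingDl pairingZl; ring.
have : wedge (- P) Q = 0.
  by apply: (support_parallel y0 (dual_leN Pp) Qq); rewrite ?pairingNl; lra.
have -> : wedge (- P) Q = (1 + al) * wedge b aj by rewrite /wedge !mxE; ring.
by move/eqP; rewrite mulf_eq0 (negPf baj) orbF => /eqP; lra.
Qed.

Lemma three_sources_contradiction (a : 'I_3 -> 'rV[R]_2) (w : 'I_3 -> R) b (wb d : R) :
  0 < d -> 0 < wb -> (forall i, 0 < w i) ->
  dual_eq b wb -> (forall i, dual_eq (a i) (w i)) ->
  (forall i j, i != j -> dual_le N (a i + a j) (w i + w j - d)) ->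
  (forall i, dual_le N (b + a i) (wb - w i + d)) -> False.
Proof.
move=> d_gt0 wb_gt0 w_gt0 bE aE aij bi.
have b0 := dual_eq_neq0 bE wb_gt0.
have cone i k (al ga : R) : i != k -> wedge b (a k) != 0 -> 0 <= al -> 0 <= ga ->
    0 < al + ga -> a i <> al *: b + ga *: a k.
  move=> ik bak al0 ga0 alga aiE.
  have h1 := aij i k ik; have h2 := bi i; rewrite aiE in h1 h2.
  apply: cone_exclusion (aE k) bE bak al0 ga0 alga _ h1 h2; ring.
(* Of two vectors strictly on the same side of the line of [b], one lies in the cone spanned by [b]
   and the other; the [wlog] chooses which. *)
have same_side i k : i != k -> ~ (0 < wedge b (a i) * wedge b (a k)).
  move=> ik; wlog le_ik : i k ik / 0 <= wedge (a i) (a k) * wedge b (a k).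
    move=> H; have [|lt0 pos] := lerP 0 (wedge (a i) (a k) * wedge b (a k)); first exact: H.
    apply: (H k i); [by rewrite eq_sym| |by rewrite mulrC].
    rewrite wedgeC; move: lt0 pos.
    move: (wedge (a i) _) (wedge b (a k)) (wedge b (a i)) => X Y Z XY ZY.
    have : 0 < (- X * Z) * (Y * Y).
      have -> : - X * Z * (Y * Y) = - (X * Y) * (Z * Y) by ring.
      by rewrite mulr_gt0 // oppr_gt0.
    have YY : 0 < Y * Y.
      by rewrite -expr2 exprn_even_gt0 //=; apply: contraTneq ZY => ->; rewrite mulr0 ltxx.
    by rewrite (pmulr_lgt0 _ YY) => /ltW.
  move=> pos.
  have bak : wedge b (a k) != 0 by apply: contraTneq pos => ->; rewrite mulr0 ltxx.
  have sq : 0 < wedge b (a k) ^+ 2 by rewrite exprn_even_gt0.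
  have qE (c : R) : c / wedge b (a k) = c * wedge b (a k) / wedge b (a k) ^+ 2 by field.
  have h1 : 0 <= wedge (a i) (a k) / wedge b (a k) by rewrite qE divr_ge0 // ltW.
  have h2 : 0 < wedge b (a i) / wedge b (a k) by rewrite qE divr_gt0.
  exact: cone ik bak h1 (ltW h2) (ltr_wpDl h1 h2) (wedge_solve _ bak).
(* With [a i = c *: b], a positive [c] is a degenerate cone with coefficient 0 on [a k], a negative
   [c] falls under [opposite_exclusion], and [c = 0] contradicts [0 < w i]. *)
have on_line i k : i != k -> wedge b (a i) = 0 -> wedge b (a k) = 0.
  move=> ik bai; apply/eqP/negP => /negP bak.
  have [c cE] := wedge0_scale b0 bai.
  have ci := aE i; rewrite cE in ci.
  have wi := dual_eq_scale bE ci.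
  have [c_gt0|c_lt0|c0] := ltgtP 0 c.
  - apply: (cone i k c 0 ik bak (ltW c_gt0) (lexx 0)); first lra.
    by rewrite scale0r addr0.
  - have aik := aij i k ik; rewrite cE -[c]opprK in aik.
    have c_pos : 0 < - c by lra.
    apply: (opposite_exclusion bE bak c_pos _ aik (bi k)).
    by rewrite wi ltr0_norm //; ring.
  - by have := w_gt0 i; rewrite wi -c0 normr0 mul0r ltxx.
(* Used twice: for the two sides of the line of [b], and for the two directions on that line. *)
have pigeon (s : 'I_3 -> R) : (forall i, s i != 0) -> exists i j, i != j /\ 0 < s i * s j.
  move=> s0.
  have sgn i : (s i < 0) || (0 < s i) by rewrite -neq_lt.
  pose i0 : 'I_3 := 0; pose i1 : 'I_3 := 1; pose i2 : 'I_3 := ord_max.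
  have [h0|h0] := orP (sgn i0); have [h1|h1] := orP (sgn i1);
    try (by exists i0, i1; split => //; nra);
    have [h2|h2] := orP (sgn i2);
    try (by exists i0, i2; split => //; nra);
    by exists i1, i2; split => //; nra.
have [/existsP[i0 /eqP i0E]|/existsPn nz] := boolP [exists i, wedge b (a i) == 0].
  have all0 i : wedge b (a i) = 0.
    by have [<-//|ii0] := eqVneq i0 i; apply: on_line ii0 i0E.
  pose c i := projT1 (cid (wedge0_scale b0 (all0 i))).
  have cE i : a i = c i *: b by rewrite /c; case: cid.
  have wE i : w i = `|c i| * wb by apply: dual_eq_scale bE _; rewrite -cE.
  have c0 i : c i != 0.
    by apply/eqP => c0; have := w_gt0 i; rewrite wE c0 normr0 mul0r ltxx.
  have [i [j [ij cij]]] := pigeon c c0.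
  have [_ [y y0 b_y]] := bE.
  (* At [y] or [- y], according to the common sign of [c i] and [c j], the pairing equals
     [(w i + w j) * N y], which exceeds the assumed bound by [d * N y]. *)
  have := aij i j ij y; have := aij i j ij (- y).
  rewrite norm_opp pairingNr pairingDl !cE !pairingZl b_y !wE => h1 h2.
  have Ny := norm_gt0 y0; have dN : 0 < d * N y by rewrite mulr_gt0.
  have [ci|ci] := orP (etrans (esym (neq_lt (c i) 0)) (c0 i)).
    have cj : c j < 0 by nra.
    by move: h1; rewrite !ltr0_norm //; lra.
  have cj : 0 < c j by nra.
  by move: h2; rewrite !gtr0_norm //; lra.
have [i [j [ij pos]]] := pigeon (fun i => wedge b (a i)) nz.
exact: same_side ij pos.
Qed.

End Planar.

(** * Simple paths and splitting in acyclic graphs *)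

Section Paths.
Context (T : eqType).
Implicit Types (e : rel T) (x y z : T) (s l r : seq T).

Definition acyclic e : Prop := forall c, (2 < size c)%N -> ~ ucycle e c.

(** Spelled as the zip in [uses_edge], so that [traverses] is convertible to the last condition
    there. *)
Definition steps x s : seq (T * T) := zip (x :: s) s.

Definition traverses x s (a b : T) : bool :=
  ((a, b) \in steps x s) || ((b, a) \in steps x s).

Lemma steps_cons x y s : steps x (y :: s) = (x, y) :: steps y s.
Proof. by []. Qed.

Lemma steps_nil x : steps x [::] = [::].
Proof. by []. Qed.

Lemma steps_cat x l r : steps x (l ++ r) = steps x l ++ steps (last x l) r.
Proof. by elim: l x => [//|y l IH] x; rewrite /= !steps_cons IH. Qed.

Lemma mem_steps x s a b : (a, b) \in steps x s -> a \in x :: s /\ b \in s.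
Proof.
elim: s x => [//|y s IH] x; rewrite steps_cons !inE => /orP[/eqP[-> ->]|/IH].
  by rewrite !eqxx.
by rewrite !inE => -[-> ->]; rewrite !orbT.
Qed.

Lemma steps_path e x s a b : path e x s -> (a, b) \in steps x s -> e a b.
Proof.
elim: s x => [//|y s IH] x /= /andP[exy ps]; rewrite steps_cons inE.
by case/orP=> [/eqP[-> ->]//|]; apply: IH.
Qed.

Lemma traversesC x s a b : traverses x s a b = traverses x s b a.
Proof. by rewrite /traverses orbC. Qed.

Lemma traverses_mem x s a b : traverses x s a b -> a \in x :: s.
Proof. by case/orP=> /mem_steps[]// _ as_; rewrite inE as_ orbT. Qed.

(** If the paths separate right after [x], then following one and returning along the other joins
    their first vertices without meeting [x]; shortened and closed up through [x], this walk is a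
    cycle. *)
Lemma simple_path_unique e x s1 s2 : symmetric e -> acyclic e ->
  path e x s1 -> path e x s2 -> uniq (x :: s1) -> uniq (x :: s2) ->
  last x s1 = last x s2 -> s1 = s2.
Proof.
move=> e_sym e_acyc; elim: s1 x s2 => [|y1 s1 IH] x [|y2 s2] //=.
- by move=> _ _ _ /andP[+ _] xE; rewrite {1}xE mem_last.
- by move=> _ _ /andP[+ _] _ xE; rewrite -{1}xE mem_last.
move=> /andP[xy1 p1] /andP[xy2 p2] /andP[xs1 us1] /andP[xs2 us2] lastE.
have [y12|y12] := eqVneq y1 y2.
  by subst y2; congr (_ :: _); apply: (IH y1).
pose back := rev (belast y2 s2).
have pw : path e y1 (s1 ++ back).
  rewrite cat_path p1 lastE rev_path.
  by rewrite (eq_path (e' := e)).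
have lw : last y1 (s1 ++ back) = y2.
  rewrite last_cat /back lastE.
  by case: (s2) => //= b s; rewrite rev_cons last_rcons.
have xw : x \notin y1 :: s1 ++ back.
  move: xs1 xs2; rewrite !inE !negb_or mem_cat mem_rev => /andP[-> xs1] /andP[xy xs2] /=.
  rewrite negb_or xs1; apply: contra xs2 => /mem_belast.
  by rewrite inE (negPf xy).
case/shortenP: pw lw => w pw uw sub lw.
(* The cycle has at least three vertices because [y1 != y2] makes [w] nonempty. *)
exfalso; apply: (e_acyc [:: x, y1 & w]).
  by case: w lw {pw uw sub} => [/eqP|//]; rewrite (negPf y12).
rewrite /ucycle /= rcons_path lw xy1 pw e_sym xy2 /=.
move: uw => /= ->; rewrite andbT.
apply: contra xw; rewrite !inE => /orP[->//|/sub ->]; exact: orbT.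
Qed.

Definition reach e x y : Prop := exists s, path e x s /\ last x s = y.

Lemma reach_trans e y x z : reach e x y -> reach e y z -> reach e x z.
Proof.
move=> [s [ps <-]] [r [pr <-]]; exists (s ++ r).
by rewrite cat_path ps pr last_cat.
Qed.

Lemma reach_edge e x y : e x y -> reach e x y.
Proof. by move=> exy; exists [:: y]; rewrite /= exy. Qed.

Lemma reach_sub e e' x y : (forall a b, e a b -> reach e' a b) ->
  reach e x y -> reach e' x y.
Proof.
move=> sub [s [ps <-]]; elim: s x ps => [|a s IH] x /=; first by exists [::].
by move=> /andP[/sub xa /IH]; apply: reach_trans.
Qed.

Lemma reach_simple e x y : reach e x y ->
  exists s, [/\ path e x s, uniq (x :: s) & last x s = y].
Proof. by move=> [s [ps]]; case/shortenP: ps => r pr ur _ <-; exists r. Qed.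

End Paths.

(** * Pulling two edges of an acyclic graph onto a new vertex *)

Section SplitGraph.
Context (T : eqType) (e : rel T) (s u v w : T).
Implicit Types (x y a b : T) (l r : seq T).

Definition pulled a b : bool :=
  ((a == s) && (b \in [:: u; v])) || ((b == s) && (a \in [:: u; v])).

(* The edges su and sv are pulled away from s to the new vertex w, which is
   joined to s. *)
Definition split_edge a b : bool :=
  if a == w then b \in [:: s; u; v] else
  if b == w then a \in [:: s; u; v] else e a b && ~~ pulled a b.

Hypotheses (e_sym : symmetric e) (e_irr : irreflexive e).
Hypotheses (esu : e s u) (esv : e s v) (uv : u != v) (ew : forall a, ~~ e a w).

Lemma edge_neq a b : e a b -> a != b.
Proof. by apply: contraTneq => ->; rewrite e_irr. Qed.

Lemma edge_newP a b : e a b -> (a != w) && (b != w).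
Proof.
move=> eab; apply/andP; split; last by apply: contraTneq eab => ->.
by apply: contraTneq eab => ->; rewrite e_sym.
Qed.

Lemma centre_neq_new : s != w.
Proof. by have /andP[] := edge_newP esu. Qed.

Lemma pulledC a b : pulled a b = pulled b a.
Proof. by rewrite /pulled orbC. Qed.

Lemma pulled_edge a b : pulled a b -> e a b.
Proof.
by rewrite /pulled !inE => /orP[]/andP[/eqP-> /orP[]/eqP->]; rewrite // e_sym.
Qed.

Lemma split_sym : symmetric split_edge.
Proof.
move=> a b; rewrite /split_edge e_sym pulledC.
by case: eqP => [->|_]; case: eqP => // ->.
Qed.

Lemma split_irr : irreflexive split_edge.
Proof.
move=> a; rewrite /split_edge e_irr; case: eqP => // ->.
have /andP[_ uw] := edge_newP esu; have /andP[_ vw] := edge_newP esv.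
by rewrite !inE !(eq_sym w) (negPf uw) (negPf vw) (negPf centre_neq_new).
Qed.

Lemma split_old a b : a != w -> b != w -> split_edge a b = e a b && ~~ pulled a b.
Proof. by rewrite /split_edge => /negPf-> /negPf->. Qed.

Lemma split_new b : split_edge w b = (b \in [:: s; u; v]).
Proof. by rewrite /split_edge eqxx. Qed.

Lemma split_newr b : split_edge b w = (b \in [:: s; u; v]).
Proof. by rewrite split_sym split_new. Qed.

(** A pulled edge is replaced by two steps through [w]; this preserves connectedness. *)
Lemma split_reach a b : e a b -> reach split_edge a b.
Proof.
move=> eab; have /andP[aw bw] := edge_newP eab.
have [ab|ab] := boolP (pulled a b); last first.
  by apply: reach_edge; rewrite split_old // eab.
apply: (@reach_trans _ _ w); apply: reach_edge.
  rewrite split_newr; move: ab.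
  by rewrite /pulled !inE => /orP[/andP[->]//|/andP[_ ->]]; rewrite orbT.
rewrite split_new; move: ab.
by rewrite /pulled !inE => /orP[/andP[_ ->]|/andP[->]//]; rewrite orbT.
Qed.

Hypothesis e_acyc : acyclic e.

(** In the old graph two neighbours of [w] are joined via [s], starting with a pulled edge, which
    the split graph lacks; [split_acyclic] rests on this. *)
Lemma pulled_path x y : x \in [:: s; u; v] -> y \in [:: s; u; v] -> x != y ->
  exists z r, [/\ path e x (z :: r), uniq (x :: z :: r), last z r = y & pulled x z].
Proof.
move=> xin yin xy.
have su := edge_neq esu; have sv := edge_neq esv.
have pl c : c \in [:: u; v] -> pulled s c by move=> cin; rewrite /pulled eqxx cin.
have [xs|xs] := eqVneq x s.
  have yin2 : y \in [:: u; v].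
    by move: yin xy; rewrite xs !inE eq_sym => /or3P[->//|->//|->]; rewrite ?orbT.
  exists y, [::]; rewrite xs pl //=; split => //.
  - by rewrite (pulled_edge (pl _ yin2)).
  - by rewrite inE -xs xy.
have xin2 : x \in [:: u; v].
  by move: xin; rewrite !inE (negPf xs).
have exs : e x s by rewrite e_sym (pulled_edge (pl _ xin2)).
have pxs : pulled x s by rewrite pulledC pl.
have [ys|ys] := eqVneq y s.
  by exists s, [::]; rewrite ys /= exs inE xs.
have yin2 : y \in [:: u; v].
  by move: yin; rewrite !inE (negPf ys).
exists s, [:: y]; split=> //=.
  by rewrite exs (pulled_edge (pl _ yin2)).
by rewrite !inE (negPf xs) (negPf xy) eq_sym (negPf ys).
Qed.

(** A cycle avoiding [w] is a cycle of [e]. Removing [w] from any other cycle leaves a simple path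
    of [e] between two neighbours of [w]; by uniqueness it is the one from [pulled_path], whose
    first step is not a split edge. *)
Lemma split_acyclic : acyclic split_edge.
Proof.
move=> c c2 ucyc.
pose old : {pred T} := fun a => a != w.
have sub : {in old &, subrel split_edge e}.
  by move=> a b aw bw; rewrite split_old // => /andP[].
have [wc|wc] := boolP (w \in c); last first.
  apply: (e_acyc c2); move: ucyc => /andP[cyc uc]; rewrite /ucycle uc andbT.
  apply: (sub_in_cycle sub _ cyc).
  by apply/allP => a ac; apply: contraNneq wc => <-.
have [i c' cE] := rot_to wc.
move: ucyc; rewrite -(rot_ucycle i) cE => ucyc {wc}.
have {c2} : (1 < size c')%N by have := size_rot i c; rewrite cE /= => c'E; rewrite -ltnS c'E.
case: c' ucyc {cE} => [//|x c'].
case/lastP: c' => [//|r y] /andP[/= /andP[wx +] /and3P[wr xr ur] _].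
rewrite rcons_path last_rcons => /andP[pr yw].
rewrite split_new in wx; rewrite split_newr in yw.
have xy : x != y by apply: contraNneq xr => ->; rewrite mem_rcons mem_head.
have [z [t [pt ut lt pxz]]] := pulled_path wx yw xy.
have wnr : all old (x :: rcons r y).
  by apply/allP => a ar; apply: contraNneq wr => <-.
have pre : path e x (rcons r y) := sub_in_path sub wnr pr.
have rE : rcons r y = z :: t.
  apply: simple_path_unique e_sym e_acyc pre pt _ ut _; first by rewrite /= xr.
  by rewrite last_rcons.
have := pr; rewrite rE /= => /andP[+ _].
by rewrite split_old ?pxz ?andbF //; apply: (allP wnr); rewrite rE !inE eqxx ?orbT.
Qed.

Lemma path_avoiding x l : x != w -> path e x l -> s \notin x :: l -> path split_edge x l.
Proof.
elim: l x => [//|y l IH] x xw /= /andP[exy pl]; rewrite inE negb_or => /andP[sx sl].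
have /andP[_ yw] := edge_newP exy.
rewrite IH // andbT split_old // exy /= /pulled eq_sym (negPf sx) /=.
by move: sl; rewrite inE negb_or eq_sym => /andP[/negPf->].
Qed.

Lemma new_notin x l : x != w -> path e x l -> w \notin x :: l.
Proof.
elim: l x => [|y l IH] x xw /=; first by rewrite inE eq_sym.
move=> /andP[exy pl]; rewrite inE negb_or eq_sym xw IH //.
by have /andP[] := edge_newP exy.
Qed.

(** Simplicity leaves a single occurrence of [s], hence one step into it and one out of it. *)
Lemma traverses_through x l y r b : uniq (x :: l ++ s :: y :: r) ->
  traverses x (l ++ s :: y :: r) s b = (b == last x l) || (b == y).
Proof.
rewrite -cat_cons cat_uniq => /and3P[_ hl ur].
have sl : s \notin x :: l by apply: contra hl => sl; apply/hasP; exists s; rewrite ?mem_head.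
move: ur; rewrite /= => /andP[+ /andP[yr ur]]; rewrite inE negb_or => /andP[sy sr].
have nl1 : (s, b) \notin steps x l by apply: contra sl => /mem_steps[].
have nl2 : (b, s) \notin steps x l.
  by apply: contra sl => /mem_steps[_ sin]; rewrite inE sin orbT.
have nr1 : (s, b) \notin steps y r.
  by apply/negP => /mem_steps[+ _]; rewrite inE (negPf sy) (negPf sr).
have nr2 : (b, s) \notin steps y r by apply: contra sr => /mem_steps[].
have sx : s != last x l by apply: contraNneq sl => ->; exact: mem_last.
rewrite /traverses !steps_cat !steps_cons !mem_cat !inE !xpair_eqE.
rewrite (negPf nl1) (negPf nl2) (negPf nr1) (negPf nr2) eqxx (negPf sx) (negPf sy) /=.
by rewrite !(andbT, andbF, orbF) orbC.
Qed.

(* [m] is [l] with a detour through [w] wherever [l] uses a pulled edge. *)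
Lemma split_lift x l : x != w -> x != s -> last x l != s -> path e x l -> uniq (x :: l) ->
  exists m, [/\ path split_edge x m /\ uniq (x :: m), last x m = last x l,
    forall a b, (a, b) \in steps x m -> a != w -> b != w -> (a, b) \in steps x l,
    forall a, a != s -> ((a, w) \in steps x m -> (a, s) \in steps x l)
                     /\ ((w, a) \in steps x m -> (s, a) \in steps x l) &
    traverses x m s w -> traverses x l s u (+) traverses x l s v].
Proof.
move=> xw xs ls pl ul.
have wl := new_notin xw pl.
(* A path that avoids [s] uses no pulled edge and is kept unchanged. *)
have [sl|sl] := boolP (s \in l); last first.
  have nw a b : traverses x l a b -> a != w /\ b != w.
    by move=> t; split; apply: contraNneq wl => <-; [|move: t; rewrite traversesC => t];
      apply: traverses_mem t.
  exists l; split=> //.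
  - by split => //; apply: path_avoiding => //; rewrite inE eq_sym (negPf xs).
  - move=> a _; split=> al.
      by have [] := nw a w; rewrite /traverses ?al ?eqxx.
    by have [] := nw w a; rewrite /traverses ?al ?eqxx.
  - by case/nw; rewrite eqxx.
case/splitPr: sl pl ul ls wl => l1 [|y r]; first by rewrite last_cat /= eqxx.
rewrite cat_path last_cat /= => /and4P[pl1 xss sy pr] ul ls wl.
have trE b := traverses_through b ul.
set z := last x l1 in xss trE *.
have : uniq (x :: l1 ++ s :: y :: r) := ul; rewrite -cat_cons -cat_rcons cat_uniq => /and3P[].
rewrite rcons_uniq => /andP[sl1 ul1] dis uyr.
have yw : y != w by have /andP[] := edge_newP sy.
have zw : z != w by have /andP[] := edge_newP xss.
have syr : s \notin y :: r.
  by apply: contra dis => sin; apply/hasP; exists s; rewrite // mem_rcons mem_head.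
have wl1 : w \notin x :: l1.
  by apply: contra wl => win; rewrite -cat_cons mem_cat win.
have wyr : w \notin y :: r.
  by apply: contra wl; rewrite !inE mem_cat !inE => /orP[]->; rewrite !orbT.
have zy : z != y.
  apply: contraNneq dis => zy; apply/hasP; exists y; rewrite ?mem_head //.
  by rewrite mem_rcons inE -zy mem_last orbT.
have dis1 : ~~ has (mem (x :: l1)) (y :: r).
  by apply: contra dis => /hasP[a ayr al1]; apply/hasP; exists a => //;
    rewrite -[X in is_true X]/(a \in rcons _ s) mem_rcons inE (al1 : a \in x :: l1) orbT.
have sp1 : path split_edge x l1 by apply: path_avoiding.
have spr : path split_edge y r by apply: path_avoiding.
have pz : pulled z s = (z \in [:: u; v]).
  by rewrite /pulled eqxx (negPf (edge_neq xss)).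
have py : pulled s y = (y \in [:: u; v]).
  by rewrite /pulled eqxx [y == s]eq_sym (negPf (edge_neq sy)) orbF.
have sw := centre_neq_new.
have zs := edge_neq xss; have ys := edge_neq sy.
have wz3 : z \in [:: u; v] -> split_edge z w.
  by rewrite split_newr !inE => ->; rewrite orbT.
have wy3 : y \in [:: u; v] -> split_edge w y.
  by rewrite split_new !inE => ->; rewrite orbT.
have sws : split_edge s w by rewrite split_newr mem_head.
have wss : split_edge w s by rewrite split_new mem_head.
have zse : z \notin [:: u; v] -> split_edge z s by move=> zn; rewrite split_old ?xss ?pz.
have sye : y \notin [:: u; v] -> split_edge s y by move=> yn; rewrite split_old ?sy ?py.
(* The path enters [s] from [z] and leaves to [y]. If both edges are pulled, it passes [w] and
   bypasses [s]; if exactly one is, it crosses the new edge between [w] and [s]; otherwise it is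
   unchanged. *)
pose mid := (if z \in [:: u; v] then if y \in [:: u; v] then [:: w] else [:: w; s]
             else if y \in [:: u; v] then [:: s; w] else [:: s]).
exists (l1 ++ mid ++ y :: r).
have wst a : ((a, w) \in steps x l1 = false) * ((w, a) \in steps x l1 = false)
    * ((a, w) \in steps y r = false) * ((w, a) \in steps y r = false).
  do !split; apply/negP => /mem_steps[i1 i2].
  - by move: wl1; rewrite inE i2 orbT.
  - by move: wl1; rewrite i1.
  - by move: wyr; rewrite inE i2 orbT.
  - by move: wyr; rewrite i1.
have sws' : w != s by rewrite eq_sym.
split.
- split.
    rewrite cat_path sp1 -/z /mid.
    by case: ifPn => zin; case: ifPn => yin /=; rewrite spr ?wz3 ?wy3 ?sws ?wss ?zse ?sye.
  rewrite -[X in is_true X]/(uniq ((x :: l1) ++ mid ++ y :: r)).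
  rewrite cat_uniq ul1 /= cat_uniq uyr andbT.
  rewrite has_cat negb_or dis1 andbT.
  apply/and3P; split.
  + have midsw a : a \in mid -> (a == s) || (a == w).
      by rewrite /mid; do 2 case: ifP => _; rewrite !inE ?(orbC (a == w)) // => ->; rewrite ?orbT.
    by apply/hasPn => a /midsw /orP[]/eqP->; [exact: sl1 | exact: wl1].
  + by rewrite /mid; do 2 case: ifP => _; rewrite //= inE ?sw ?sws'.
  + apply/hasPn => a ayr; rewrite /mid.
    have aw : a != w by apply: contraNneq wyr => <-.
    have as_ : a != s by apply: contraNneq syr => <-.
    by do 2 case: ifP => _; rewrite !inE ?(negPf aw) ?(negPf as_).
- by rewrite !last_cat.
- move=> a b; rewrite !steps_cat !steps_cons !mem_cat -/z.
  move=> + aw bw; rewrite /mid.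
  by do 2 case: ifP => _; rewrite /= ?steps_cons ?mem_cat !inE !xpair_eqE ?(negPf aw) ?(negPf bw)
    ?andbF ?orbF /=; do ?case/orP; move=> ->; rewrite ?orbT.
- move=> a as_; rewrite !steps_cat !steps_cons !mem_cat -/z.
  rewrite !inE !xpair_eqE !wst /mid ?eqxx.
  by case: ifPn => zin; case: ifPn => yin; split; rewrite /= ?steps_cons ?inE ?xpair_eqE
    ?eqxx ?(negPf as_) ?[w == y]eq_sym ?[w == z]eq_sym ?(negPf yw) ?(negPf zw)
    ?(negPf sw) ?(negPf sws')
    ?andbF ?andbT ?orbF //= => ->; rewrite ?orbT.
- rewrite !trE {trE}; rewrite /traverses !steps_cat !mem_cat !wst -/z /mid.
  (* The new edge is crossed only when exactly one of [z], [y] is in [{u, v}], that is, when exactly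
     one of the edges su and sv is used. *)
  have pair2 c c' : c \in [:: u; v] -> c' \notin [:: u; v] ->
      ((u == c) || (u == c')) (+) ((v == c) || (v == c')).
    rewrite !inE => /orP[]/eqP-> /norP[]; rewrite ![_ == c']eq_sym => /negPf-> /negPf->.
      by rewrite eqxx [v == u]eq_sym (negPf uv).
    by rewrite eqxx (negPf uv).
  case: ifPn => zin; case: ifPn => yin.
  + by rewrite /= !steps_cons steps_nil !inE !xpair_eqE wst ?[s == z]eq_sym ?(negPf zs)
      ?(negPf ys) ?(negPf sw) ?(negPf sws') ?andbF /= ?wst.
  + by move=> _; apply: pair2.
  + by move=> _; rewrite ![(_ == z) || _]orbC; apply: pair2.
  + by rewrite /= !steps_cons steps_nil !inE !xpair_eqE wst ?(negPf sw) ?(negPf sws')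
      ?[w == y]eq_sym ?(negPf yw) ?[w == z]eq_sym ?(negPf zw) ?andbF /= ?wst.
Qed.

End SplitGraph.

(** * Splitting a Steiner point of an arborescence *)

Section Flows.
Context (R : realType) (n : nat) (p : 'I_n -> 'rV[R]_2) (q : 'rV[R]_2).
Implicit Types (A B : arborescence p q) (a b : 'rV[R]_2).

Lemma uses_edge_path A (i : 'I_n) : exists l,
  [/\ path (edge A) (p i) l, uniq (p i :: l), last (p i) l = q
    & forall a b, uses_edge A i a b = traverses (p i) l a b].
Proof.
have [l [pl ul ll]] := reach_simple (tree_connected (source_verts A i) (sink_verts A)).
exists l; split=> // a b; apply/asboolP/idP; last by exists l.
move=> [m [pm um lm]].
have -> // : m = l.
apply: simple_path_unique (@edge_sym _ _ _ _ A) (@tree_acyclic _ _ _ _ A) pm pl um ul _.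
by rewrite lm ll.
Qed.

Lemma uses_edge_from A i l : path (edge A) (p i) l -> uniq (p i :: l) -> last (p i) l = q ->
  forall a b, uses_edge A i a b = traverses (p i) l a b.
Proof.
move=> pl ul ll; have [m [pm um lm E]] := uses_edge_path A i => a b; rewrite E.
congr traverses.
apply: simple_path_unique (@edge_sym _ _ _ _ A) (@tree_acyclic _ _ _ _ A) pm pl um ul _.
by rewrite lm ll.
Qed.

Lemma uses_edgeC A i a b : uses_edge A i a b = uses_edge A i b a.
Proof. by have [l [_ _ _ E]] := uses_edge_path A i; rewrite !E traversesC. Qed.

Lemma flowC (t : 'I_n -> R) A a b : flow t A a b = flow t A b a.
Proof. by apply: eq_bigl => i; rewrite uses_edgeC. Qed.

Context (t : 'I_n -> R).
Hypothesis t_ge0 : forall i, 0 <= t i.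

Lemma sum_flow_le (P Q : pred 'I_n) : (forall i, P i -> Q i) ->
  \sum_(i | P i) t i <= \sum_(i | Q i) t i.
Proof.
move=> PQ; rewrite big_mkcond [leRHS]big_mkcond; apply: ler_sum => i _.
by case: ifP => [/PQ->//|_]; case: ifP.
Qed.

Lemma flow_ge0 A a b : 0 <= flow t A a b.
Proof. by apply: sumr_ge0. Qed.

(* [v] is the neighbour of [s] on the way to the sink. *)
Lemma parent_exists A s : steiner_point A s ->
  exists2 v, edge A s v &
    forall i u, uses_edge A i s u -> uses_edge A i s v.
Proof.
move=> /andP[sV]; rewrite /terminal negb_or => /andP[sq /existsPn sp].
have [[|v r] [pr ur lr]] := reach_simple (tree_connected sV (sink_verts A)).
  by rewrite -lr eqxx in sq.
exists v => [|i u]; first by case/andP: pr.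
have [l [pl ul ll E]] := uses_edge_path A i; rewrite !E => su.
have sl : s \in l.
  by have := traverses_mem su; rewrite inE (negPf (sp i)).
case/splitPr: sl pl ul ll su {E} => l1 l2.
rewrite cat_path last_cat => /= /and3P[_ _ p2] ul l2q.
(* After reaching [s], every source path continues along the unique simple path from [s] to the
   sink. *)
have vE : l2 = v :: r.
  apply: simple_path_unique (@edge_sym _ _ _ _ A) (@tree_acyclic _ _ _ _ A) p2 pr _ ur _.
    by have : uniq (p i :: l1 ++ s :: l2) := ul; rewrite -cat_cons cat_uniq => /and3P[].
  by rewrite l2q lr.
by rewrite vE in ul *; rewrite !(traverses_through _ ul) eqxx orbT.
Qed.

End Flows.

Section SplitArborescence.
Context (R : realType) (n : nat) (p : 'I_n -> 'rV[R]_2) (q : 'rV[R]_2).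
Context (A : arborescence p q) (s u v w : 'rV[R]_2).
Hypotheses (s_steiner : steiner_point A s) (s_degree : (3 < degree A s)%N).
Hypotheses (esu : edge A s u) (esv : edge A s v) (uv : u != v) (w_new : w \notin verts A).

Let e_sym := @edge_sym _ _ _ _ A.
Let e_irr := @edge_irr _ _ _ _ A.
Let e_acyc : acyclic (edge A) := @tree_acyclic _ _ _ _ A.

Lemma edge_vertl a b : edge A a b -> a \in verts A.
Proof. by case/edge_verts/andP. Qed.

Lemma edge_vertr a b : edge A a b -> b \in verts A.
Proof. by case/edge_verts/andP. Qed.

Lemma no_edge_new a : ~~ edge A a w.
Proof. by apply: contra w_new => /edge_vertr. Qed.

Let ew := no_edge_new.
Let e' := split_edge (edge A) s u v w.
Let V' := w |` verts A.

Lemma old_neq_new a : a \in verts A -> a != w.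
Proof. by apply: contraTneq => ->. Qed.

Lemma split_adjacent x : (x \in [:: s; u; v]) -> x \in verts A.
Proof.
by rewrite !inE => /or3P[]/eqP->;
  [exact: edge_vertl esu | exact: edge_vertr esu | exact: edge_vertr esv].
Qed.

Lemma split_edge_verts a b : e' a b -> (a \in V') && (b \in V').
Proof.
rewrite /e' /split_edge /V' !in_fset1U.
have [_ /split_adjacent -> |aw] := eqVneq a w; first by rewrite orbT.
have [_ /split_adjacent -> |bw] := eqVneq b w; first by [].
by case/andP=> eab _; rewrite (edge_vertl eab) (edge_vertr eab).
Qed.

Lemma split_connected a b : a \in V' -> b \in V' -> reach e' a b.
Proof.
have sV := edge_vertl esu.
have ws : e' w s by rewrite /e' split_new mem_head.
have sw : e' s w by rewrite /e' split_sym.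
have reach_s x : x \in V' -> reach e' x s /\ reach e' s x.
  rewrite /V' in_fset1U => /predU1P[->|xV]; first by split; apply: reach_edge.
  by split; apply: (reach_sub (split_reach s u v e_sym ew)); apply: tree_connected.
by move=> /reach_s[ra _] /reach_s[_ rb]; apply: reach_trans ra rb.
Qed.

Lemma split_source i : p i \in V'.
Proof. by rewrite in_fset1U source_verts orbT. Qed.

Lemma split_sink : q \in V'.
Proof. by rewrite in_fset1U sink_verts orbT. Qed.

(** The new vertex has the neighbours [s], [u], [v]. The point [s] loses two of at least four
    neighbours and gains [w]. At any other vertex the old neighbours inject into the new ones, with
    [w] replacing [s] at [u] and [v]. *)
Lemma split_degree a : a \in V' -> ~~ terminal p q a ->
  (3 <= #|` [fset b in V' | e' a b]|)%N.
Proof.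
have uV := edge_vertr esu; have vV := edge_vertr esv; have sV := edge_vertl esu.
rewrite /V' in_fset1U => /predU1P[-> _|aV a_nt].
  have sub : [fset s; u; v] `<=` [fset b in w |` verts A | e' w b].
    apply/fsubsetP => x; rewrite !inE /= /e' split_new !inE => /orP[/orP[]|] /eqP->;
      by rewrite eqxx ?uV ?vV ?sV ?orbT.
  apply: leq_trans (fsubset_leq_card sub).
  rewrite fsetUC cardfsU1 cardfs2 !inE negb_or (edge_neq e_irr esu).
  by rewrite [v == s]eq_sym (edge_neq e_irr esv) [v == u]eq_sym uv.
have [->|as_] := eqVneq a s.
  pose K := [fset b in verts A | edge A s b].
  have sub : w |` (K `\ u `\ v) `<=` [fset b in w |` verts A | e' s b].
    apply/fsubsetP => x; rewrite !inE /=; case/predU1P=> [->|].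
      by rewrite eqxx /= /e' split_newr // mem_head.
    move=> /and4P[xv xu xV sx]; rewrite xV orbT /=.
    rewrite /e' split_old ?old_neq_new ?edge_vertl // sx /pulled eqxx !inE.
    by rewrite (negPf xv) (negPf xu) [x == s]eq_sym (negPf (edge_neq e_irr sx)).
  apply: leq_trans (fsubset_leq_card sub).
  rewrite cardfsU1 !inE !negb_and w_new !orbT.
  have : (3 < #|` K|)%N := s_degree.
  rewrite (cardfsD1 u) (cardfsD1 v (K `\ u)).
  by rewrite !inE; do 2 case: (_ && _); rewrite /= ?add0n ?add1n // => /ltnW // /leqW.
pose f x := if (x == s) && (a \in [:: u; v]) then w else x.
pose K := [fset b in verts A | edge A a b].
have Kw x : x \in K -> x != w by rewrite !inE /= => /andP[xV _]; apply: old_neq_new.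
have f_inj : {in K &, injective f}.
  move=> x y /Kw xw /Kw yw; rewrite /f.
  case: ifP => [/andP[/eqP-> ain]|_]; case: ifP => [/andP[/eqP->]|_] //.
    by move=> wy; rewrite -wy eqxx in yw.
  by move=> _ xE; rewrite xE eqxx in xw.
have sub : f @` K `<=` [fset b in w |` verts A | e' a b].
  apply/fsubsetP => _ /imfsetP[x /= + ->]; rewrite !inE /= => /andP[xV ax].
  rewrite /f; case: ifP => [/andP[/eqP _ ain]|nx].
    by rewrite eqxx /= /e' split_newr // inE ain orbT.
  rewrite xV orbT /e' split_old ?old_neq_new // ax /pulled (negPf as_) /=.
  by rewrite nx.
apply: leq_trans (fsubset_leq_card sub).
rewrite (eqP (introT (card_in_imfsetP f K) f_inj)).
exact: steiner_degree.
Qed.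

Definition split_arborescence : arborescence p q :=
  Arborescence split_edge_verts (split_sym s u v w e_sym)
    (split_irr e_sym e_irr esu esv ew) split_connected
    (split_acyclic (w := w) e_sym e_irr esu esv e_acyc)
    split_source split_sink split_degree.

Local Notation B := split_arborescence.

(** As [s] is not a terminal, [split_lift] applies to the path from [p i], and by uniqueness its
    result is the path in the split tree. Implications suffice, because the weight is nondecreasing
    in the flow. *)
Lemma split_uses i :
  [/\ forall a b, a != w -> b != w -> uses_edge B i a b -> uses_edge A i a b,
    forall a, a != s -> uses_edge B i a w -> uses_edge A i a s &
    uses_edge B i s w -> uses_edge A i s u (+) uses_edge A i s v].
Proof.
have [l [pl ul ll E]] := uses_edge_path A i.
have /andP[_ s_nt] := s_steiner.
have [sq sp] : s != q /\ s != p i.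
  by move: s_nt; rewrite negb_or => /andP[-> /existsPn /(_ i)].
have pw : p i != w by apply: old_neq_new; apply: source_verts.
have ps : p i != s by rewrite eq_sym.
have ls : last (p i) l != s by rewrite ll eq_sym.
have [m [[pm um] lm h1 h2 h3]] := split_lift e_sym e_irr esu uv ew pw ps ls pl ul.
have lmq : last (p i) m = q by rewrite lm ll.
have EB := uses_edge_from (A := B) pm um lmq.
split; rewrite ?EB ?E //.
- by move=> a b aw bw; rewrite EB E => /orP[]/h1 h; apply/orP; [left|right]; apply: h.
- move=> a /h2[h4 h5]; rewrite EB E => /orP[]/[dup].
    by move/h4=> h _; apply/orP; left.
  by move/h5=> h _; apply/orP; right.
Qed.

End SplitArborescence.

(** * First-order cost of a splitting *)

Lemma ler_sum_in (R : realType) (T : eqType) (V : seq T) (F G : T -> R) :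
  {in V, forall a, F a <= G a} -> \sum_(a <- V) F a <= \sum_(a <- V) G a.
Proof. by move=> FG; rewrite [leLHS]big_seq [leRHS]big_seq; apply: ler_sum. Qed.

Lemma sum_single (R : realType) (T : choiceType) (V : {fset T}) (x : T) (c : R) : x \in V ->
  \sum_(a <- V) (if a == x then c else 0) = c.
Proof.
move=> xV; rewrite (bigD1_seq x) ?fset_uniq //= eqxx.
by rewrite big1 ?addr0 // => a /negPf ->.
Qed.

Lemma sum_single2 (R : realType) (T : choiceType) (V : {fset T}) (x y : T) (c : R) :
  x \in V -> y \in V ->
  \sum_(a <- V) \sum_(b <- V) (if (a == x) && (b == y) then c else 0) = c.
Proof.
move=> xV yV; rewrite -[RHS](sum_single c xV); apply: eq_bigr => a _.
by case: (a == x) => /=; [exact: sum_single | rewrite big1].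
Qed.

Section SplitCost.
Context (R : realType) (N : 'rV[R]_2 -> R) (d h : R).
Context (n : nat) (p : 'I_n -> 'rV[R]_2) (q : 'rV[R]_2) (t : 'I_n -> R).
Hypotheses (N_norm : is_norm N) (d_gt0 : 0 < d) (h_ge0 : 0 <= h).
Hypothesis t_gt0 : forall i, 0 < t i.

Let t_ge0 i : 0 <= t i := ltW (t_gt0 i).
Local Notation weight x := (d + h * x).

(** Edge by edge: flows on the remaining edges do not grow, the edges wu and wv carry at most what
    su and sv did, and [F] bounds the flow on the new edge sw. *)
Lemma split_cost (A : arborescence p q) (s u v w : 'rV[R]_2) (F : R) :
  steiner_point A s -> (3 < degree A s)%N -> edge A s u -> edge A s v -> u != v ->
  w \notin verts A ->
  \sum_(i < n | uses_edge A i s u (+) uses_edge A i s v) t i <= F ->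
  exists B : arborescence p q,
    cost N (fun x => d + h * x) t B <= cost N (fun x => d + h * x) t A
      + weight (flow t A s u) * (N (u - w) - N (u - s))
      + weight (flow t A s v) * (N (v - w) - N (v - s))
      + weight F * N (s - w).
Proof.
move=> s_st s_deg esu esv uv w_new hF.
pose B := split_arborescence s_deg esu esv uv w_new; exists B.
have uses i := split_uses s_st s_deg esu esv uv w_new i.
have e_irr := @edge_irr _ _ _ _ A; have e_sym := @edge_sym _ _ _ _ A.
have ew := no_edge_new w_new.
have [uV vV sV] : [/\ u \in verts A, v \in verts A & s \in verts A].
  by rewrite (edge_vertr esu) (edge_vertr esv) (edge_vertl esu).
have su := edge_neq e_irr esu; have sv := edge_neq e_irr esv.
have nw a : a \in verts A -> a != w by apply: old_neq_new.
have wle x y a : x <= y -> weight x * N a <= weight y * N a.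
  by move=> xy; rewrite ler_wpM2r ?(norm_ge0 N_norm) // lerD2l ler_wpM2l.
have fl_old a b : a \in verts A -> b \in verts A -> flow t B a b <= flow t A a b.
  move=> aV bV; apply: sum_flow_le => // i.
  by have [h1 _ _] := uses i; apply: h1; apply: nw.
have fl_new a : a != s -> flow t B a w <= flow t A s a.
  move=> as_; rewrite [leRHS]flowC; apply: sum_flow_le => // i.
  by have [_ h2 _] := uses i; apply: h2.
have fl_s : flow t B s w <= F.
  apply: le_trans hF; apply: sum_flow_le => // i.
  by have [_ _] := uses i.
pose GB a b := if edge B a b then weight (flow t B a b) * N (a - b) else 0.
pose CA a b := weight (flow t A a b) * N (a - b).
pose GA a b := if edge A a b then CA a b else 0.
(* [D x y] puts the cost of a removed edge at one ordered pair; four copies cover both orientations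
   of su and sv. *)
pose D x y a b := if (a == x) && (b == y) then CA x y else 0.
have CAC a b : CA a b = CA b a by rewrite /CA flowC -opprB (norm_opp N_norm).
have NC a b : N (a - b) = N (b - a) by rewrite -opprB (norm_opp N_norm).
have GBC a b : GB a b = GB b a.
  by rewrite /GB flowC (@edge_sym _ _ _ _ B) NC.
have costA : cost N (fun x => d + h * x) t A =
    2^-1 * \sum_(a <- verts A) \sum_(b <- verts A) GA a b.
  by rewrite /cost; congr (_ * _); apply: eq_bigr => a _; rewrite big_mkcond.
have costB : cost N (fun x => d + h * x) t B =
    2^-1 * \sum_(a <- w |` verts A) \sum_(b <- w |` verts A) GB a b.
  by rewrite /cost; congr (_ * _); apply: eq_bigr => a _; rewrite big_mkcond.
have GBww : GB w w = 0 by rewrite /GB (@edge_irr _ _ _ _ B).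
have GB_new a : a \in verts A -> GB a w <=
    (if a == s then weight F * N (s - w) else 0)
  + (if a == u then weight (flow t A s u) * N (u - w) else 0)
  + (if a == v then weight (flow t A s v) * N (v - w) else 0).
  move=> aV; rewrite /GB /= split_newr // !inE.
  have [->|as_] := eqVneq a s.
    by rewrite (negPf su) (negPf sv) /= !addr0 wle.
  have [->|au] := eqVneq a u.
    by rewrite (negPf uv) /= addr0 add0r wle // fl_new // eq_sym.
  have [->|av] := eqVneq a v; last by rewrite /= !addr0.
  by rewrite /= !add0r wle // fl_new // eq_sym.
have GB_old a b : a \in verts A -> b \in verts A ->
    GB a b + D s u a b + D u s a b + D s v a b + D v s a b <= GA a b.
  move=> aV bV; rewrite /GB /GA /= split_old ?nw //.
  have [pab|npab] := boolP (pulled s u v a b).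
    rewrite (pulled_edge e_sym esu esv pab) andbF.
    move: pab; rewrite /pulled !inE /D.
    case/orP => /andP[/eqP-> /orP[]/eqP->]; rewrite !eqxx ?(negPf su) ?(negPf sv) ?(negPf uv)
      ?[u == s]eq_sym ?[v == s]eq_sym ?[v == u]eq_sym ?(negPf su) ?(negPf sv) ?(negPf uv) /=;
      by rewrite ?addr0 ?add0r.
  have D0 x y : pulled s u v x y -> D x y a b = 0.
    move=> pxy; rewrite /D; case: ifP => // /andP[/eqP ax /eqP b_y].
    by rewrite ax b_y pxy in npab.
  rewrite !D0 ?addr0 ?andbT //; try by rewrite /pulled !inE !eqxx ?orbT.
  by case: ifP => // _; apply: wle; apply: fl_old.
(* Each edge at [w] is counted in both orientations; this 2 cancels the factor 1/2 in [cost]. *)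
have sumB : \sum_(a <- w |` verts A) \sum_(b <- w |` verts A) GB a b =
    2 * \sum_(a <- verts A) GB a w + \sum_(a <- verts A) \sum_(b <- verts A) GB a b.
  rewrite big_fsetU1 //= big_fsetU1 //= GBww add0r.
  under [X in _ + X]eq_bigr => a _ do rewrite big_fsetU1 //=.
  rewrite big_split /= addrA; congr (_ + _); rewrite mulr2n mulrDl mul1r.
  by congr (_ + _); apply: eq_bigr => a _; rewrite GBC.
have le_new : \sum_(a <- verts A) GB a w <= weight F * N (s - w)
   + weight (flow t A s u) * N (u - w) + weight (flow t A s v) * N (v - w).
  rewrite -[X in _ <= X + _ + _](sum_single _ sV) -[X in _ <= _ + X + _](sum_single _ uV).
  rewrite -[X in _ <= _ + _ + X](sum_single _ vV) -!big_split /=.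
  apply: ler_sum_in => a aV; exact: GB_new.
have le_old : \sum_(a <- verts A) \sum_(b <- verts A) GB a b
    + CA s u + CA u s + CA s v + CA v s <= \sum_(a <- verts A) \sum_(b <- verts A) GA a b.
  rewrite -[X in _ + X + _ + _ + _](sum_single2 _ sV uV).
  rewrite -[X in _ + _ + X + _ + _](sum_single2 _ uV sV).
  rewrite -[X in _ + _ + _ + X + _](sum_single2 _ sV vV).
  rewrite -[X in _ + _ + _ + _ + X](sum_single2 _ vV sV) -!big_split /=.
  apply: ler_sum_in => a aV; rewrite -!big_split /=.
  apply: ler_sum_in => b bV; exact: GB_old.
rewrite [CA u s]CAC [CA v s]CAC /CA [N (s - u)]NC [N (s - v)]NC in le_old.
rewrite costA costB sumB; lra.
Qed.

(** Makes the new vertex distinct from the old ones: as [z] is nonzero, each point of [V] rules out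
    at most one [eps]. *)
Lemma avoid_finite (V : seq 'rV[R]_2) (s z : 'rV[R]_2) : z != 0 ->
  exists2 r, 0 < r & forall eps, 0 < eps -> eps < r -> s + eps *: z \notin V.
Proof.
move=> z0; elim: V => [|a V [r r_gt0 hr]]; first by exists 1.
have [[e0 [e0_gt0 aE]]|none] := pselect (exists e0, 0 < e0 /\ a = s + e0 *: z).
  exists (Num.min r e0); first by rewrite lt_min r_gt0.
  move=> eps eps_gt0; rewrite lt_min => /andP[eps_r eps_e0].
  rewrite inE negb_or hr // andbT aE; apply: contraTneq eps_e0 => /addrI /eqP.
  rewrite -subr_eq0 -scalerBl scaler_eq0 (negPf z0) orbF subr_eq0 => /eqP->.
  by rewrite ltxx.
exists r => // eps eps_gt0 eps_r; rewrite inE negb_or hr // andbT.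
by apply: contra_notN none => /eqP <-; exists eps.
Qed.

Lemma weight_gt0 x : 0 <= x -> 0 < weight x.
Proof. by move=> x0; rewrite ltr_pwDl // mulr_ge0. Qed.

(** Put the new vertex at [s + eps *: z]. By minimality the change in cost is nonnegative; dividing
    it by [eps] and letting [eps] tend to 0 gives the bound in the direction [z]. *)
Lemma split_dual_le (A : arborescence p q) (s u v gu gv : 'rV[R]_2) (F : R) :
  minimum_arborescence N (fun x => d + h * x) t A ->
  steiner_point A s -> (3 < degree A s)%N -> edge A s u -> edge A s v -> u != v ->
  \sum_(i < n | uses_edge A i s u (+) uses_edge A i s v) t i <= F ->
  gradient N (u - s) gu -> gradient N (v - s) gv ->
  dual_le N (weight (flow t A s u) *: gu + weight (flow t A s v) *: gv) (weight F).
Proof.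
move=> A_min s_st s_deg esu esv uv hF hu hv z.
have [->|z0] := eqVneq z 0.
  by rewrite -(scale0r z) pairingZr (norm_homog N_norm) normr0 !mul0r mulr0.
set wu := weight _; set wv := weight (flow t A s v).
have wu_gt0 : 0 < wu by apply: weight_gt0; apply: flow_ge0.
have wv_gt0 : 0 < wv by apply: weight_gt0; apply: flow_ge0.
apply/ler_addgt0Pr => e e_gt0.
have W_gt0 : 0 < wu + wv by rewrite addr_gt0.
(* Chosen so that the two error terms, weighted by [wu] and [wv], add up to [eps * e]. *)
pose e1 := e / (wu + wv).
have e1_gt0 : 0 < e1 by rewrite divr_gt0.
have [ru ru_gt0 hru] := hu (- z) _ e1_gt0.
have [rv rv_gt0 hrv] := hv (- z) _ e1_gt0.
have [r r_gt0 hr] := avoid_finite (enum_fset (verts A)) s z0.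
pose r0 := Num.min r (Num.min ru rv).
have r0_gt0 : 0 < r0 by rewrite !lt_min r_gt0 ru_gt0.
pose eps := r0 / 2.
have eps_gt0 : 0 < eps by rewrite divr_gt0.
have : eps < r0 by rewrite /eps; lra.
rewrite !lt_min => /and3P[eps_r eps_ru eps_rv].
have [B hB] := split_cost s_st s_deg esu esv uv (hr _ eps_gt0 eps_r) hF.
have := le_trans (A_min B) hB.
have /ler_normlP[_ ] := hru _ eps_gt0 eps_ru.
have /ler_normlP[_ ] := hrv _ eps_gt0 eps_rv.
rewrite !pairingNr !scalerN !(opprD s) !addrA.
have -> : s - s - eps *: z = - (eps *: z) by rewrite subrr add0r.
rewrite (norm_opp N_norm) (norm_homog N_norm) gtr0_norm // -/wu -/wv.
set nu := N (u - s - _); set nv := N (v - s - _) => h1 h2 h3.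
rewrite pairingDl !pairingZl -(ler_pM2l eps_gt0).
have h1' := ler_wpM2l (ltW wv_gt0) h1; have h2' := ler_wpM2l (ltW wu_gt0) h2.
have eE : wu * (e1 * eps) + wv * (e1 * eps) = eps * e.
  by rewrite /e1; field; rewrite gt_eqF.
lra.
Qed.

(** Supplies [F] when two children are pulled away. *)
Lemma xor_flow_le (A : arborescence p q) (s u v : 'rV[R]_2) :
  \sum_(i < n | uses_edge A i s u (+) uses_edge A i s v) t i <= flow t A s u + flow t A s v.
Proof.
rewrite /flow big_mkcond [X in _ <= X + _]big_mkcond [X in _ <= _ + X]big_mkcond -big_split /=.
apply: ler_sum => i _.
by have := t_ge0 i; do 2 case: (uses_edge _ _ _ _) => /=; lra.
Qed.

(** Supplies [F] when a child [u] is pulled away with the parent [v]: the flow through [u] goes on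
    to [v] without crossing the new edge. *)
Lemma xor_flow_parent (A : arborescence p q) (s u v : 'rV[R]_2) :
  (forall i, uses_edge A i s u -> uses_edge A i s v) ->
  \sum_(i < n | uses_edge A i s u (+) uses_edge A i s v) t i <= flow t A s v - flow t A s u.
Proof.
move=> sub; rewrite lerBrDr /flow big_mkcond [X in _ + X]big_mkcond [leRHS]big_mkcond -big_split /=.
apply: ler_sum => i _.
have := sub i; have := t_ge0 i.
by case: (uses_edge _ _ _ u); case: (uses_edge _ _ _ v) => //= h0 h1; rewrite ?addr0 ?add0r //;
  have := h1 isT.
Qed.

End SplitCost.

(** * First-order conditions assembled at a Steiner point *)

Theorem theorem2 (R : realType) (N : 'rV[R]_2 -> R)
    (N_norm : is_norm N) (N_smooth : smooth_norm N)
    (d h : R) (d_gt0 : 0 < d) (h_ge0 : 0 <= h)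
    (n : nat) (p : 'I_n -> 'rV[R]_2) (q : 'rV[R]_2) (t : 'I_n -> R)
    (p_inj : injective p) (p_neq_q : forall i, p i != q)
    (t_gt0 : forall i, 0 < t i)
    (A : arborescence p q)
    (A_min : minimum_arborescence N (fun x => d + h * x) t A)
    (s : 'rV[R]_2) (s_steiner : steiner_point A s) :
  degree A s = 3%N.
Proof.
have deg3 : (3 <= degree A s)%N.
  by case/andP: (s_steiner) => sV s_nt; apply: steiner_degree.
apply/eqP; rewrite eqn_leq deg3 andbT leqNgt; apply/negP => deg4.
have [v esv parent] := parent_exists s_steiner.
pose K := [fset x in verts A | edge A s x] `\ v.
have K3 : (3 <= #|` K|)%N.
  have := deg4; rewrite /degree (cardfsD1 v) -/K.
  by case: (v \in _); rewrite ?add0n ?add1n //; apply: ltnW.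
(* Three children of [s]; the default 0 is never returned, since [K] has at least three elements. *)
pose c (i : 'I_3) := nth 0 (enum_fset K) i.
have cK i : c i \in K by apply: mem_nth; apply: leq_trans (ltn_ord i) K3.
have c_neq i j : i != j -> c i != c j.
  by move=> ij; rewrite /c nth_uniq ?fset_uniq //; apply: leq_trans (ltn_ord _) K3.
have cv i : c i != v by have := cK i; rewrite !inE => /andP[].
have esc i : edge A s (c i) by have := cK i; rewrite !inE => /and3P[].
have e_irr := @edge_irr _ _ _ _ A.
have grad u : edge A s u -> {g | gradient N (u - s) g}.
  move=> esu; apply: cid; apply: differentiable_gradient; apply: N_smooth.
  by rewrite subr_eq0 eq_sym (edge_neq e_irr esu).
pose g i := projT1 (grad _ (esc i)).
have gE i : gradient N (c i - s) (g i) := projT2 (grad _ (esc i)).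
have [gv gvE] := grad v esv.
pose f u := flow t A s u; pose weight u := d + h * f u.
have weight_pos u : 0 < weight u.
  by apply: weight_gt0 => //; apply: flow_ge0 => i; apply: ltW.
have deq u k : edge A s u -> gradient N (u - s) k -> dual_eq N (weight u *: k) (weight u).
  move=> esu kE; split=> [z|].
    rewrite pairingZl ler_wpM2l ?(ltW (weight_pos u)) //.
    by have := gradient_dual_le N_norm kE z; rewrite mul1r.
  exists (u - s); first by rewrite subr_eq0 eq_sym (edge_neq e_irr esu).
  by rewrite pairingZl (gradient_self N_norm kE).
apply: (three_sources_contradiction N_norm N_smooth (a := fun i => weight (c i) *: g i)
  (w := fun i => weight (c i)) (b := weight v *: gv) (wb := weight v) d_gt0).
- exact: weight_pos.
- by move=> i; apply: weight_pos.
- exact: deq.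
- by move=> i; apply: deq.
- move=> i j ij.
  (* Merging two edges pays the fixed cost [d] once instead of twice. *)
  have -> : weight (c i) + weight (c j) - d = d + h * (f (c i) + f (c j)).
    by rewrite /weight; ring.
  by apply: (split_dual_le N_norm d_gt0 h_ge0 t_gt0 A_min) => //;
    [exact: c_neq | exact: xor_flow_le].
- move=> i.
  (* The fixed costs cancel in the difference, so one [d] is restored for the new edge. *)
  have -> : weight v - weight (c i) + d = d + h * (f v - f (c i)).
    by rewrite /weight; ring.
  rewrite addrC.
  apply: (split_dual_le N_norm d_gt0 h_ge0 t_gt0 A_min) => //.
  by apply: xor_flow_parent => // k; apply: parent.
Qed.
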